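(* Let $Z, Y, A$ be discrete random variables defined on a common probability space. Then $$0 \leq I(Z;Y) \leq I(Z;A) + H(Y|A).$$
   Context: All random variables are discrete. $I(U;V)=\sum_{u,v} p(u,v)\log\frac{p(u,v)}{p(u)p(v)}$ denotes the (Shannon) mutual information of discrete random variables $U,V$ and $H(U|V)=-\sum_{u,v}p(u,v)\log p(u|v)$ denotes the conditional (Shannon) entropy of $U$ given $V$, where the sums run over pairs $(u,v)$ with $p(u,v)>0$. No independence, Markov or functional relation among $Z,Y,A$ is assumed. (Interpretation: $Y$ is a prediction target, $A$ a protected attribute, and $Z$ a learnt feature.) *)

(* Defs.v *)
From HB Require Import structures.
From mathcomp Require Import all_boot all_order all_algebra.
From mathcomp Require Import all_classical all_reals all_analysis.

Set Implicit Arguments.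
Unset Strict Implicit.
Unset Printing Implicit Defensive.

Import Order.TTheory GRing.Theory Num.Theory.
Import numFieldNormedType.Exports.

Local Open Scope classical_set_scope.
Local Open Scope ring_scope.

(** Unordered sum of a family of arbitrary sign, with values in [\bar R].
    [esum] alone would be wrong here: on a signed family it only sees the
    positive terms. The value is the genuine sum as soon as the positive or the
    negative part has a finite sum. *)
Definition signed_esum (R : realType) (I : choiceType) (D : set I)
    (f : I -> \bar R) : \bar R :=
  (esum D f^\+ - esum D f^\-)%E.

Section shannon.
Context {d dU dV : measure_display} {T : measurableType d}
  {TU : measurableType dU} {TV : measurableType dV} {R : realType}.
Variable P : probability T R.

(** [pmf] of the library is restricted to real-valued random variables. *)
Definition marginal_pmf (U : {dRV P >-> TU}) (u : TU) : R :=
  fine (P (U @^-1` [set u])).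

Definition joint_pmf (U : {dRV P >-> TU}) (V : {dRV P >-> TV})
    (u : TU) (v : TV) : R :=
  fine (P (U @^-1` [set u] `&` V @^-1` [set v])).

Definition joint_supp (U : {dRV P >-> TU}) (V : {dRV P >-> TV}) :
    set (TU * TV) :=
  [set uv | 0 < joint_pmf U V uv.1 uv.2].

End shannon.

Section information.
Context {d dU dV : measure_display} {T : measurableType d}
  {TU : measurableType dU} {TV : measurableType dV} {R : realType}.
Variables (P : probability T R) (U : {dRV P >-> TU}) (V : {dRV P >-> TV}).

Definition cond_pmf (u : TU) (v : TV) : R :=
  joint_pmf U V u v / marginal_pmf V v.

(** Logarithms are natural, and both quantities may be [+oo] when the ranges are
    infinite. Since [p * ln (q / p) <= q - p], the negative terms of the mutual
    information always have a finite sum. *)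
Definition mutual_information : \bar R :=
  signed_esum (joint_supp U V) (fun uv =>
    (joint_pmf U V uv.1 uv.2 *
     ln (joint_pmf U V uv.1 uv.2 /
         (marginal_pmf U uv.1 * marginal_pmf V uv.2)))%:E).

Definition cond_entropy : \bar R :=
  (- signed_esum (joint_supp U V) (fun uv =>
      (joint_pmf U V uv.1 uv.2 * ln (cond_pmf uv.1 uv.2))%:E))%E.

End information.

(* Main.v *)
Require Import Defs.
From mathcomp Require Import all_boot all_order all_algebra.
From mathcomp Require Import all_classical all_reals all_analysis.
From mathcomp Require Import lra.

(** In the finite case I(Z;A) + H(Y|A) - I(Z;Y) = H(Y|Z,A) + I(Z;A|Y) >= 0.
    Since the entropies may be infinite, no difference is formed: for each value
    of the triple, [ln x <= x - 1] compares the summands of both sides up to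
    q - p, where p is the law of (Z,Y,A) and q(z,y,a) = p(z,y) p(y,a) / p(y).
    The inequality is then summed over all triples, with positive and negative
    parts on the sides where they are added. The negative parts of the mutual
    informations are summable because [(p ln (p / q))^- <= q]. *)

Set Implicit Arguments.
Unset Strict Implicit.
Unset Printing Implicit Defensive.

Import Order.TTheory GRing.Theory Num.Theory.

Local Open Scope classical_set_scope.
Local Open Scope ring_scope.

(** * Unordered sums: scaling, regrouping and comparison *)

Section esum_extra.
Context {R : realType}.
Local Open Scope ereal_scope.

Lemma esumZl (I : choiceType) (D : set I) (a : I -> \bar R) (c : R) :
  (0 <= c)%R -> (forall i, 0 <= a i) ->
  \esum_(i in D) (c%:E * a i) = c%:E * \esum_(i in D) a i.
Proof.
move=> c0 a0; rewrite /esum -ereal_supZl//; last first.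
  apply/set0P; exists (\sum_(i \in set0) a i).
  by exists set0; first exact: fsets_set0.
congr ereal_sup; apply/seteqP.
split=> [_ [X XD <-]|_ [_ [X XD <-] <-]].
  by exists (\sum_(i \in X) a i); [exists X|rewrite ge0_mule_fsumr].
by exists X; rewrite // ge0_mule_fsumr.
Qed.

Lemma esum_setX (I J : choiceType) (a : I * J -> \bar R) :
  (forall k, 0 <= a k) ->
  \esum_(k in [set: I * J]) a k =
  \esum_(i in [set: I]) \esum_(j in [set: J]) a (i, j).
Proof.
move=> a0; rewrite (@esum_esum _ _ _ _ (fun=> setT) (fun i j => a (i, j)))//.
rewrite (_ : setT `*`` _ = setT); last by apply/seteqP; split=> //= -[].
by apply: eq_esum => -[].
Qed.

Lemma esum_fibers (I J : choiceType) (f : I -> J) (a : I -> \bar R) :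
  (forall i, 0 <= a i) ->
  \esum_(i in [set: I]) a i =
  \esum_(j in [set: J]) \esum_(i in f @^-1` [set j]) a i.
Proof.
move=> a0; rewrite (@esum_esum _ _ _ _ _ (fun=> a))//.
(* Each [i] lies in exactly one fibre, so the graph of [f] enumerates the dependent pairs. *)
rewrite (reindex_esum [set: I] _ (fun i => (f i, i)))//; split.
- by move=> i _ /=.
- by move=> i j _ _ [].
- by move=> [j i] [_ /= <-]; exists i.
Qed.

(** Removes the supports, which differ from pair to pair, so that all sums run over full
    products. *)
Lemma signed_esum_supp (I : choiceType) (D : set I) (f : I -> \bar R) :
  (forall i, ~ D i -> f i = 0) -> signed_esum D f = signed_esum setT f.
Proof.
move=> f0; rewrite /signed_esum (esum_mkcond D f^\+) (esum_mkcond D f^\-).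
congr (_ - _); apply: eq_esum => i _; case: ifPn => // /negP;
  by rewrite inE => /f0 fi0; rewrite ?funeposE ?funenegE fi0 ?oppe0 maxxx.
Qed.

Lemma signed_esum0 (I : choiceType) (D : set I) :
  signed_esum D (fun=> 0 : \bar R) = 0.
Proof.
rewrite /signed_esum !esum1 ?sube0// => i _.
  by rewrite funenegE oppe0 maxxx.
by rewrite funeposE maxxx.
Qed.

(** [p] and [q] absorb the error of a pointwise comparison: Gibbs' inequality
    bounds a logarithm only up to [q - p], whose total is not positive. *)
Lemma signed_esum_le (I : choiceType) (f g h p q : I -> R) :
  (forall i, (0 <= h i)%R) -> (forall i, (0 <= p i)%R) ->
  (forall i, (0 <= q i)%R) ->
  (forall i, (f i + p i <= g i + h i + q i)%R) ->
  \esum_(i in setT) (p i)%:E < +oo ->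
  \esum_(i in setT) (q i)%:E <= \esum_(i in setT) (p i)%:E ->
  \esum_(i in setT) (EFin \o f)^\- i < +oo ->
  \esum_(i in setT) (EFin \o g)^\- i < +oo ->
  signed_esum setT (EFin \o f) <=
  signed_esum setT (EFin \o g) + \esum_(i in setT) (h i)%:E.
Proof.
move=> h0 p0 q0 fgh ply qp fly gly.
have fin (a : I -> \bar R) : (forall i, 0 <= a i) ->
    \esum_(i in setT) a i < +oo -> \esum_(i in setT) a i \is a fin_num.
  by move=> a0 aly; rewrite ge0_fin_numE// esum_ge0.
rewrite /signed_esum leeBlDr ?fin// addeAC -addeA addeAC leeBrDr ?fin//.
(* The total of [p] is finite, so adding it to both sides is reversible. On the right it is then
   lowered to the total of [q], after which the comparison is termwise. *)
rewrite -(leeD2rE _ _ (fin _ _ ply)) => [|i]; last by rewrite lee_fin.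
rewrite (le_trans _ (leeD2l _ qp))//.
have P0 (u : I -> \bar R) i : setT i -> 0 <= u^\+ i by [].
have N0 (u : I -> \bar R) i : setT i -> 0 <= u^\- i by [].
rewrite -!esumD//=; try by move=> *; rewrite ?adde_ge0 ?lee_fin.
apply: le_esum => i _; rewrite !funeposE !funenegE /= -!EFin_max -!EFinD.
rewrite lee_fin; have := fgh i; rewrite /Num.max.
by do ![case: ifPn]; rewrite -?leNgt => *; lra.
Qed.

End esum_extra.

(** * Pointwise logarithmic inequalities *)

Section log_inequalities.
Context {R : realType}.
Implicit Types p q : R.

(** This is [ln x <= x - 1] at [x = q / p], multiplied by [- p]. For [p = 0] the right side is
    [0]. *)
Lemma ge0_mul_ln_ratio p q : 0 <= p -> 0 <= q -> (0 < p -> 0 < q) ->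
  p - q <= p * ln (p / q).
Proof.
move=> p0 q0; case: (ltgtP 0 p) p0 => [p0 _ /(_ erefl) {}q0||<- _ _];
  last 2 first.
- by [].
- by rewrite mul0r sub0r oppr_le0.
have pq : ln (q / p) <= q / p - 1.
  have := @le_ln1Dx _ (q / p - 1).
  by rewrite subrKC; apply; rewrite ltrBrDl subrr divr_gt0.
have -> : ln (p / q) = - ln (q / p) by rewrite -lnV ?invf_div// posrE divr_gt0.
have := ler_wpM2l (ltW p0) pq.
rewrite mulrBr mulrCA divff ?gt_eqF// !mulr1 mulrN; lra.
Qed.

Lemma neg_mul_ln_ratio_le p q : 0 <= p -> 0 <= q -> (0 < p -> 0 < q) ->
  Num.max (- (p * ln (p / q))) 0 <= q.
Proof.
by move=> p0 q0 pq; have := ge0_mul_ln_ratio p0 q0 pq; rewrite ge_max q0; lra.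
Qed.

(** With [q = p(y,a) p(z,y) / p(y)], the logarithms on the right exceed the one
    on the left by [ln (p(z,a) / q) >= ln (p / q) >= 1 - q / p]. *)
Lemma mul_ln_ratio_triple_le (p pzy pza pya pz py pa : R) : 0 <= p ->
  p <= pzy -> p <= pza -> p <= pya -> p <= pz -> p <= py -> p <= pa ->
  p * ln (pzy / (pz * py)) + p <=
  p * ln (pza / (pz * pa)) + p * - ln (pya / pa) + pya * pzy / py.
Proof.
move=> p0; case: (ltgtP 0 p) p0 => [p0 _||<- _]; first last.
- by move=> *; rewrite !mul0r !add0r divr_ge0 ?mulr_ge0.
- by [].
move=> ppzy ppza ppya ppz ppy ppa.
have [pzy0 pza0 pya0] : [/\ 0 < pzy, 0 < pza & 0 < pya].
  by split; exact: lt_le_trans p0 _.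
have [pz0 py0 pa0] : [/\ 0 < pz, 0 < py & 0 < pa].
  by split; exact: lt_le_trans p0 _.
set q := pya * pzy / py.
have q0 : 0 < q by rewrite divr_gt0 ?mulr_gt0.
have pq : p - q <= p * ln (p / q).
  by apply: ge0_mul_ln_ratio => //; exact: ltW.
have : ln (p / q) <= ln pza - ln q.
  rewrite -ln_div ?posrE// ler_ln ?posrE ?(divr_gt0 _ q0)//.
  by rewrite ler_pM2r ?invr_gt0.
move=> /(ler_wpM2l (ltW p0)) /(le_trans pq).
have -> : ln q = ln pya + ln pzy - ln py.
  by rewrite ln_div ?lnM ?posrE ?mulr_gt0.
by rewrite !(ln_div, lnM) ?posrE ?mulr_gt0// => pqE; lra.
Qed.

End log_inequalities.

(** * Laws of discrete maps and of their projections *)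

Section law.
Context {d : measure_display} {T : measurableType d} {R : realType}.
Variable P : probability T R.

(** [W] carries no sigma-algebra, so that [law] applies to tuples of discrete
    random variables and to their projections alike. *)
Definition law (W : pointedType) (X : T -> W) (w : W) : R :=
  fine (P (X @^-1` [set w])).

(** Measurable fibres suffice without a sigma-algebra on [W]: every preimage is a countable union of
    fibres. *)
Definition discrete (W : Type) (X : T -> W) : Prop :=
  countable (range X) /\ forall w, measurable (X @^-1` [set w]).

Lemma discrete_pair (W W' : Type) (X : T -> W) (Y : T -> W') :
  discrete X -> discrete Y -> discrete (fun t => (X t, Y t)).
Proof.
move=> [cX mX] [cY mY]; split.
  apply: sub_countable (countableX cX cY); apply: subset_card_le.
  by move=> _ [t _ <-]; split; exists t.
move=> [x y]; rewrite (_ : _ @^-1` _ = X @^-1` [set x] `&` Y @^-1` [set y]).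
  exact: measurableI.
by apply/seteqP; split=> t /= => [[]|[-> ->]].
Qed.

(** Countable additivity: the nonempty fibres are disjoint and enumerated by a countable set. Taking
    [D] to be an event of another variable gives the marginals of a joint law. *)
Lemma esum_measure_fibers (W : pointedType) (X : T -> W) (B : set W)
    (D : set T) : discrete X -> measurable D ->
  (\esum_(w in B) P (D `&` X @^-1` [set w]) = P (D `&` X @^-1` B))%E.
Proof.
move=> [cX mX] mD.
have : countable (B `&` range X).
  by apply: sub_countable cX; exact: subset_card_le.
move/countable_bijP => [N]; rewrite card_eq_sym => /card_set_bijP[e eN].
have -> : D `&` X @^-1` B = \bigcup_(n in N) (D `&` X @^-1` [set e n]).
  rewrite -setI_bigcupr; congr (_ `&` _); apply/seteqP; split=> t /=.
    move=> BXt; have [_ _ /(_ (X t))] := eN.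
    by case=> [|n Nn eXt]; [split=> //; exists t|exists n].
  by move=> [n Nn /= ->]; have [/(_ n Nn)[]] := eN.
rewrite measure_bigcup; last 2 first.
- by move=> n _; exact: measurableI.
- move=> m n Nm Nn [t [[_ /= Xm] [_ /= Xn]]]; have [_ + _] := eN.
  by apply; rewrite ?inE// -Xm -Xn.
rewrite nneseries_esum// set_mem_set.
rewrite -(reindex_esum N _ e (fun w => P (D `&` X @^-1` [set w])) eN).
(* Points of [B] outside the range have empty fibres and add nothing. *)
rewrite esum_mkcondr; apply: eq_esum => w _; case: ifPn => // /negP.
rewrite inE => Xw; rewrite (_ : _ `&` _ = set0) ?measure0//.
by apply/seteqP; split=> t //= [_ Xt]; apply: Xw; exists t.
Qed.

Lemma law_ge0 (W : pointedType) (X : T -> W) w : 0 <= law X w.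
Proof. exact: fine_ge0. Qed.

Lemma lawE (W : pointedType) (X : T -> W) w : discrete X ->
  (law X w)%:E = P (X @^-1` [set w]).
Proof. by move=> [_ mX]; rewrite /law fineK// fin_num_measure. Qed.

Lemma le_law (W W' : pointedType) (X : T -> W) (f : W -> W') w :
  discrete X -> discrete (f \o X) -> law X w <= law (f \o X) (f w).
Proof.
move=> dX dfX; rewrite -lee_fin !lawE//; apply: le_measure; rewrite ?inE.
- exact: dX.2.
- exact: dfX.2.
- by move=> t /= ->.
Qed.

Lemma esum_law (W : pointedType) (X : T -> W) : discrete X ->
  (\esum_(w in setT) (law X w)%:E = 1)%E.
Proof.
move=> dX; rewrite -(probability_setT P).
have := esum_measure_fibers setT dX (@measurableT _ T).
by rewrite setTI preimage_setT => <-; apply: eq_esum => w _; rewrite lawE ?setTI.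
Qed.

(** Change of variables: [g \o f] is constant on each fibre of [f], and the law of [X] gives that
    fibre the mass that [f \o X] gives its base point. *)
Lemma esum_law_comp (W W' : pointedType) (X : T -> W) (f : W -> W')
    (g : W' -> R) : discrete X -> discrete (f \o X) -> (forall v, 0 <= g v) ->
  (\esum_(w in setT) (law X w * g (f w))%:E =
   \esum_(v in setT) (law (f \o X) v * g v)%:E)%E.
Proof.
move=> dX dfX g0; rewrite (esum_fibers f); last first.
  by move=> w; rewrite lee_fin mulr_ge0 ?law_ge0.
apply: eq_esum => v _.
transitivity (\esum_(w in f @^-1` [set v]) ((g v)%:E * (law X w)%:E))%E.
  by apply: eq_esum => w /= ->; rewrite -EFinM mulrC.
rewrite esumZl//; last by move=> w; rewrite lee_fin law_ge0.
rewrite mulrC EFinM; congr (_ * _)%E; rewrite lawE//.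
have := esum_measure_fibers (f @^-1` [set v]) dX (@measurableT _ T).
by rewrite setTI => <-; apply: eq_esum => w _; rewrite lawE ?setTI.
Qed.

Lemma esum_funepos_law (W W' : pointedType) (X : T -> W) (f : W -> W')
    (g : W' -> R) : discrete X -> discrete (f \o X) ->
  (\esum_(w in setT) (fun w => (law X w * g (f w))%:E)^\+ w =
   \esum_(v in setT) (fun v => (law (f \o X) v * g v)%:E)^\+ v)%E.
Proof.
move=> dX dfX; have posE (U : pointedType) (Z : T -> U) (k : U -> R) u :
    ((fun w => (law Z w * k w)%:E)^\+ u = (law Z u * Num.max (k u) 0)%:E)%E.
  by rewrite funeposE -EFin_max maxr_pMr ?law_ge0// mulr0.
under eq_esum do rewrite posE.
under [RHS]eq_esum do rewrite posE.
rewrite (esum_law_comp dX dfX (g := fun v => Num.max (g v) 0))// => v.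
by rewrite le_max lexx orbT.
Qed.

Lemma esum_funeneg_law (W W' : pointedType) (X : T -> W) (f : W -> W')
    (g : W' -> R) : discrete X -> discrete (f \o X) ->
  (\esum_(w in setT) (fun w => (law X w * g (f w))%:E)^\- w =
   \esum_(v in setT) (fun v => (law (f \o X) v * g v)%:E)^\- v)%E.
Proof.
move=> dX dfX; rewrite -!funeposN.
have := esum_funepos_law (fun v => - g v) dX dfX.
under [X in X^\+%E]eq_fun do rewrite mulrN.
under [X in _ = esum _ (X^\+%E)]eq_fun do rewrite mulrN.
by [].
Qed.

(** Lifts sums over pairs to sums over triples, so that different mutual informations share one
    index set. Both parts transfer separately because the weights are nonnegative. *)
Lemma signed_esum_law (W W' : pointedType) (X : T -> W) (f : W -> W')
    (g : W' -> R) : discrete X -> discrete (f \o X) ->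
  signed_esum setT (fun w => (law X w * g (f w))%:E) =
  signed_esum setT (fun v => (law (f \o X) v * g v)%:E).
Proof.
move=> dX dfX.
congr (_ - _)%E; [exact: esum_funepos_law|exact: esum_funeneg_law].
Qed.

(** * Information inequalities in terms of laws *)

Lemma esum_law_prod (W W' : pointedType) (U : T -> W) (V : T -> W') :
  discrete U -> discrete V ->
  (\esum_(w in [set: W * W']) (law U w.1 * law V w.2)%:E = 1)%E.
Proof.
move=> dU dV; rewrite esum_setX; last first.
  by move=> w; rewrite lee_fin mulr_ge0 ?law_ge0.
rewrite -(esum_law dU); apply: eq_esum => u _ /=.
under eq_esum do rewrite EFinM.
rewrite esumZl ?law_ge0//; last by move=> v; rewrite lee_fin law_ge0.
by rewrite esum_law// mule1.
Qed.

Lemma law_pair_gt0 (W W' : pointedType) (U : T -> W) (V : T -> W') w :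
  discrete U -> discrete V ->
  0 < law (fun t => (U t, V t)) w -> 0 < law U w.1 * law V w.2.
Proof.
move=> dU dV /lt_le_trans w0; have dUV := discrete_pair dU dV.
by rewrite mulr_gt0 ?w0// ?(le_law (f := fst))// (le_law (f := snd)).
Qed.

(** The event of the pair lies in that of its second component, so the ratio is at most [1]; if
    [law V w.2] is [0], division by zero makes the ratio [0]. *)
Lemma cond_surprisal_ge0 (W W' : pointedType) (U : T -> W) (V : T -> W') w :
  discrete U -> discrete V ->
  0 <= - ln (law (fun t => (U t, V t)) w / law V w.2).
Proof.
move=> dU dV; rewrite oppr_ge0 ln_le0//; have [->|V0] := eqVneq (law V w.2) 0.
  by rewrite invr0 mulr0.
rewrite ler_pdivrMr ?lt0r ?V0 ?law_ge0// mul1r.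
exact: (@le_law _ _ _ snd _ (discrete_pair dU dV)).
Qed.

(** The pointwise mutual information, in nats. *)
Definition mi_density (W W' : pointedType) (U : T -> W) (V : T -> W')
    (w : W * W') : R :=
  ln (law (fun t => (U t, V t)) w / (law U w.1 * law V w.2)).

Lemma esum_funeneg_mi_lty (W W' : pointedType) (U : T -> W) (V : T -> W') :
  discrete U -> discrete V ->
  (\esum_(w in setT) (fun w => (law (fun t => (U t, V t)) w *
     mi_density U V w)%:E)^\- w < +oo)%E.
Proof.
move=> dU dV.
apply: (@le_lt_trans _ _ (\esum_(w in setT) (law U w.1 * law V w.2)%:E)%E).
  apply: le_esum => w _; rewrite funenegE -EFinN -EFin_max lee_fin.
  apply: neg_mul_ln_ratio_le; rewrite ?mulr_ge0 ?law_ge0//.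
  exact: law_pair_gt0.
by rewrite esum_law_prod// ltry.
Qed.

(** Gibbs' inequality for the joint law [p] against the product [q] of its marginals: [p - q] bounds
    each term from below, and both laws have total mass [1]. *)
Lemma signed_esum_mi_ge0 (W W' : pointedType) (U : T -> W) (V : T -> W') :
  discrete U -> discrete V ->
  (0 <= signed_esum setT (fun w => (law (fun t => (U t, V t)) w *
     mi_density U V w)%:E))%E.
Proof.
move=> dU dV; have dUV := discrete_pair dU dV.
have := @signed_esum_le R (W * W')%type (fun=> 0)
  (fun w => law (fun t => (U t, V t)) w * mi_density U V w) (fun=> 0)
  (law (fun t => (U t, V t))) (fun w => law U w.1 * law V w.2).
rewrite signed_esum0 (esum1 (a := fun=> 0%E))// adde0.
rewrite esum_law// esum_law_prod//; apply => //.
- by move=> w; exact: law_ge0.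
- by move=> w; rewrite mulr_ge0 ?law_ge0.
- move=> w; rewrite add0r addr0 -lerBlDr.
  apply: ge0_mul_ln_ratio; rewrite ?mulr_ge0 ?law_ge0//.
  exact: law_pair_gt0.
- by rewrite ltry.
- by rewrite esum1 ?ltry// => w _; rewrite funenegE/= oppr0 maxxx.
- exact: esum_funeneg_mi_lty.
Qed.

(** [p(y,a) p(z,y) / p(y)] is the law of the triple for which [Z] and [A] are
    conditionally independent given [Y]. *)
Lemma esum_law_cond_indep (WZ WY WA : pointedType)
    (Z : T -> WZ) (Y : T -> WY) (A : T -> WA) :
  discrete Z -> discrete Y -> discrete A ->
  (\esum_(w in [set: WZ * WY * WA])
     (law (fun t => (Y t, A t)) (w.1.2, w.2) * law (fun t => (Z t, Y t)) w.1
      / law Y w.1.2)%:E <= 1)%E.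
Proof.
move=> dZ dY dA; have [dZY dYA] := (discrete_pair dZ dY, discrete_pair dY dA).
rewrite esum_setX; last first.
  by move=> w; rewrite lee_fin divr_ge0 ?mulr_ge0 ?law_ge0.
(* Summing over [a] first turns p(y,a) into p(y), which cancels the denominator and leaves p(z,y),
   of total [1]. *)
rewrite -(esum_law dZY); apply: le_esum => -[z y] _ /=.
pose c := law (fun t => (Z t, Y t)) (z, y) / law Y y.
have c0 : 0 <= c by rewrite divr_ge0 ?law_ge0.
under eq_esum do rewrite -mulrA mulrC EFinM -/c.
rewrite esumZl//; last by move=> a; rewrite lee_fin law_ge0.
have -> : (\esum_(a in setT) (law (fun t => (Y t, A t)) (y, a))%:E =
           (law Y y)%:E)%E.
  rewrite lawE//; have := esum_measure_fibers setT dA (dY.2 y).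
  rewrite preimage_setT setIT => <-; apply: eq_esum => a _; rewrite lawE//.
  by congr (P _); apply/seteqP; split=> t /= => [[]|[-> ->]].
(* No cancellation is possible when p(y) is [0], but then the left side is [0]. *)
rewrite -EFinM lee_fin /c; have [->|y0] := eqVneq (law Y y) 0.
  by rewrite mulr0 law_ge0.
by rewrite divfK.
Qed.

Lemma signed_esum_mi_le (WZ WY WA : pointedType)
    (Z : T -> WZ) (Y : T -> WY) (A : T -> WA) :
  discrete Z -> discrete Y -> discrete A ->
  (signed_esum setT (fun w => (law (fun t => (Z t, Y t)) w *
     mi_density Z Y w)%:E) <=
   signed_esum setT (fun w => (law (fun t => (Z t, A t)) w *
     mi_density Z A w)%:E) +
   \esum_(w in setT) (law (fun t => (Y t, A t)) w *
     - ln (law (fun t => (Y t, A t)) w / law A w.2))%:E)%E.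
Proof.
move=> dZ dY dA.
have dZY := discrete_pair dZ dY; have dZA := discrete_pair dZ dA.
have dYA := discrete_pair dY dA.
pose X t := (Z t, Y t, A t); have dX : discrete X by exact: discrete_pair.
pose fZA (w : WZ * WY * WA) := (w.1.1, w.2).
pose fYA (w : WZ * WY * WA) := (w.1.2, w.2).
rewrite -(signed_esum_law (f := fst) (mi_density Z Y) dX)//.
rewrite -(signed_esum_law (f := fZA) (mi_density Z A) dX)//.
rewrite -(esum_law_comp (f := fYA) dX)//; last first.
  by move=> w; exact: cond_surprisal_ge0.
(* The error terms are the law of the triple and its conditionally independent counterpart; the
   latter has total mass at most [1]. *)
apply: (@signed_esum_le _ _ _ _ _ (law X) (fun w =>
  law (fun t => (Y t, A t)) (fYA w) * law (fun t => (Z t, Y t)) w.1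
  / law Y w.1.2)).
- by move=> w; rewrite mulr_ge0 ?law_ge0 ?cond_surprisal_ge0.
- by move=> w; exact: law_ge0.
- by move=> w; rewrite divr_ge0 ?mulr_ge0 ?law_ge0.
(* Each remaining bound holds because the event of a triple lies in that of its projection. *)
- move=> w; apply: mul_ln_ratio_triple_le; first exact: law_ge0.
  + exact: (@le_law _ _ X fst).
  + exact: (@le_law _ _ X fZA).
  + exact: (@le_law _ _ X fYA).
  + exact: (@le_law _ _ X (fun w => w.1.1)).
  + exact: (@le_law _ _ X (fun w => w.1.2)).
  + exact: (@le_law _ _ X snd).
- by rewrite esum_law// ltry.
- by rewrite (esum_law dX) esum_law_cond_indep.
- rewrite (esum_funeneg_law (f := fst) (mi_density Z Y) dX)//.
  exact: esum_funeneg_mi_lty.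
- rewrite (esum_funeneg_law (f := fZA) (mi_density Z A) dX)//.
  exact: esum_funeneg_mi_lty.
Qed.

End law.

(** * Translation of the information quantities into laws *)

Lemma dRV_discrete (d dU : measure_display) (T : measurableType d)
    (TU : measurableType dU) (R : realType) (P : probability T R)
    (U : {dRV P >-> TU}) :
  (forall u : TU, measurable [set u]) -> discrete U.
Proof.
move=> m1; split; first exact: countable_range.
by move=> u; rewrite -[X in measurable X]setTI; exact: measurable_funP.
Qed.

Section discrete_random_variables.
Context {d dU dV : measure_display} {T : measurableType d}
  {TU : measurableType dU} {TV : measurableType dV} {R : realType}.
Variable P : probability T R.

Lemma joint_pmfE (U : {dRV P >-> TU}) (V : {dRV P >-> TV}) w :
  joint_pmf U V w.1 w.2 = law P (fun t => (U t, V t)) w.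
Proof.
rewrite /joint_pmf /law; congr (fine (P _)).
by case: w => u v; apply/seteqP; split=> t /= => [[-> ->]|[]].
Qed.

Lemma joint_pmf_eq0 (U : {dRV P >-> TU}) (V : {dRV P >-> TV}) w :
  ~ joint_supp U V w -> joint_pmf U V w.1 w.2 = 0.
Proof.
move=> /negP; rewrite -leNgt => w0; apply/eqP.
by rewrite eq_le w0 joint_pmfE law_ge0.
Qed.

Lemma mutual_informationE (U : {dRV P >-> TU}) (V : {dRV P >-> TV}) :
  mutual_information U V = signed_esum setT (fun w =>
    (law P (fun t => (U t, V t)) w * mi_density P U V w)%:E).
Proof.
rewrite /mutual_information signed_esum_supp; last first.
  by move=> w /joint_pmf_eq0 ->; rewrite mul0r.
by congr signed_esum; apply/funext => w; rewrite joint_pmfE.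
Qed.

(** Logarithms of conditional probabilities are nonpositive, so the positive part vanishes and the
    signed sum reduces to one of nonnegative terms. *)
Lemma cond_entropyE (U : {dRV P >-> TU}) (V : {dRV P >-> TV}) :
  (forall u : TU, measurable [set u]) -> (forall v : TV, measurable [set v]) ->
  (cond_entropy U V = \esum_(w in setT) (law P (fun t => (U t, V t)) w *
    - ln (law P (fun t => (U t, V t)) w / law P V w.2))%:E)%E.
Proof.
move=> /(dRV_discrete U) discU /(dRV_discrete V) discV.
rewrite /cond_entropy signed_esum_supp; last first.
  by move=> w /joint_pmf_eq0 ->; rewrite mul0r.
have lnUV w := cond_surprisal_ge0 P w discU discV.
rewrite /signed_esum esum1 ?sub0e ?oppeK; last first.
  move=> w _; rewrite funeposE /cond_pmf joint_pmfE; apply/max_idPr.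
  by rewrite lee_fin -oppr_ge0 -mulrN mulr_ge0 ?law_ge0.
apply: eq_esum => w _; rewrite funenegE /cond_pmf joint_pmfE -EFinN mulrN.
by apply/max_idPl; rewrite lee_fin -mulrN mulr_ge0 ?law_ge0.
Qed.

End discrete_random_variables.

Local Open Scope ereal_scope.

Theorem theorem1 (d dZ dY dA : measure_display) (Omega : measurableType d)
    (TZ : measurableType dZ) (TY : measurableType dY) (TA : measurableType dA)
    (R : realType) (P : probability Omega R)
    (measurable_set1Z : forall z : TZ, measurable [set z])
    (measurable_set1Y : forall y : TY, measurable [set y])
    (measurable_set1A : forall a : TA, measurable [set a])
    (Z : {dRV P >-> TZ}) (Y : {dRV P >-> TY}) (A : {dRV P >-> TA}) :
  0 <= mutual_information Z Y /\
  mutual_information Z Y <= mutual_information Z A + cond_entropy Y A.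
Proof.
have discZ := dRV_discrete Z measurable_set1Z.
have discY := dRV_discrete Y measurable_set1Y.
have discA := dRV_discrete A measurable_set1A.
rewrite !mutual_informationE cond_entropyE//.
by split; [exact: signed_esum_mi_ge0|exact: signed_esum_mi_le].
Qed.
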